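(* Let $V$ be a finite-dimensional complex vector space, let $A$ be a linear transformation on $V$, and let $$V=V_1\oplus\cdots\oplus V_s,\qquad A=A_1\oplus\cdots\oplus A_s,\qquad A_j=\lambda_jI_j+N_j\quad(j=1,\ldots,s)$$ be its primary decomposition. Suppose the indices are ordered so that there are integers $0=s_0<s_1<\cdots<s_t=s$ such that indices $i,j\in\{1,\ldots,s\}$ lie in the same set $\{s_{l-1}+1,\ldots,s_l\}$ $(1\le l\le t)$ if and only if $N_i$ and $N_j$ are similar. For $l=1,\ldots,t$ let $$W_l=V_{s_{l-1}+1}\oplus\cdots\oplus V_{s_l},\qquad B_l=A_{s_{l-1}+1}\oplus\cdots\oplus A_{s_l}\ \text{ (a linear transformation on } W_l).$$ Then $\mathrm{Col}(A)=\mathrm{Col}(B_1)\oplus\cdots\oplus\mathrm{Col}(B_t)$.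
   Context: Primary decomposition: $\lambda_1,\ldots,\lambda_s$ are the pairwise distinct eigenvalues of $A$, the minimal polynomial of $A$ is $(z-\lambda_1)^{n_1}\cdots(z-\lambda_s)^{n_s}$, $V_j=\ker\bigl((A-\lambda_jI)^{n_j}\bigr)$, $A_j$ is the restriction of $A$ to $V_j$, $I_j$ is the identity on $V_j$, and $N_j=A_j-\lambda_jI_j$ is nilpotent. Transformations $N_i$ on $V_i$ and $N_j$ on $V_j$ are similar if there is an invertible linear map $S\colon V_i\to V_j$ with $N_j=SN_iS^{-1}$. For a linear transformation $C$ on a finite-dimensional complex space $U$, $\mathrm{Lat}(C)$ is the lattice of all subspaces $M\subseteq U$ with $CM\subseteq M$, and $\mathrm{Col}(C)$ is the group of all invertible linear transformations $S$ on $U$ such that for every subspace $M$ of $U$ one has $M\in\mathrm{Lat}(C)\iff SM\in\mathrm{Lat}(C)$. $\mathrm{Col}(B_1)\oplus\cdots\oplus\mathrm{Col}(B_t)$ denotes the set of all block-diagonal transformations $T_1\oplus\cdots\oplus T_t$ on $V=W_1\oplus\cdots\oplus W_t$ with $T_l\in\mathrm{Col}(B_l)$. *)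

(* Defs.v *)
From mathcomp Require Import all_boot all_order all_algebra.
From mathcomp Require Import classical_sets.

Set Implicit Arguments.
Unset Strict Implicit.
Unset Printing Implicit Defensive.

Import GRing.Theory.
Local Open Scope ring_scope.

Section Operators.
Variables (K : fieldType) (V : vectType K).
Implicit Types (A C S : 'End(V)) (U M : {vspace V}).

Definition lfun_pow A (k : nat) : 'End(V) := iter k (comp_lfun A) \1%VF.

Definition lfun_horner A (p : {poly K}) : 'End(V) :=
  \sum_(i < size p) p`_i *: lfun_pow A i.

(* The ring structure of 'End(V) in the library requires V != 0, hence the
   explicit powers and evaluation above. For V = 0 the minimal polynomial
   is 1. *)
Definition is_minpoly A (p : {poly K}) : Prop :=
  [/\ p \is monic, lfun_horner A p = 0 &
      forall q : {poly K}, q != 0 -> lfun_horner A q = 0 ->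
        (size p <= size q)%N].

(* vsproj U is the identity on U, so this is the restriction of A to U as soon
   as U is A-invariant. *)
Definition restr U A : 'End(subvs_of U) :=
  (linfun (@vsproj K V U) \o A \o linfun (@vsval K V U))%VF.

Definition Lat C : set {vspace V} := [set M : {vspace V} | (C @: M <= M)%VS]%classic.

Definition Col C : set 'End(V) :=
  [set S : 'End(V) | bijective S /\
           forall M : {vspace V}, Lat C M <-> Lat C (S @: M)%VS]%classic.

Section DirectSum.
Variables (I : finType) (U : I -> {vspace V}).

(* For a direct sum of the U i with P i, sumv_pi _ i is the projection onto
   U i along the other summands, so the transformation below maps
   \sum_i u_i to \sum_i T i u_i. It is meaningful on \sum_(i | P i) U i. *)
Definition dsum (P : pred I) (T : forall i, 'End(subvs_of (U i))) : 'End(V) :=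
  \sum_(i | P i)
     (linfun (@vsval K V (U i)) \o T i \o linfun (@vsproj K V (U i))
        \o sumv_pi (\sum_(j | P j) U j)%VS i)%VF.

Definition dsum_set (G : forall i, set 'End(subvs_of (U i))) : set 'End(V) :=
  [set dsum xpredT T | T in [set T : forall i, 'End(subvs_of (U i)) | forall i, G i (T i)]]%classic.

End DirectSum.
End Operators.

(* For bijective S, S^-1%VF is the inverse of S. *)
Definition lfun_similar (K : fieldType) (V W : vectType K)
    (N : 'End(V)) (N' : 'End(W)) : Prop :=
  exists S : 'Hom(V, W), bijective S /\ N' = (S \o N \o S^-1)%VF.

(* Main.v *)
(** Let S be in Col(A). Since S maps invariant lines to invariant lines, it maps
    eigenvectors to eigenvectors; since S (x + y) is again an eigenvector when
    x and y belong to the same eigenvalue, S maps each eigenspace into a single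
    eigenspace. An A-invariant subspace is the sum of its intersections with the
    V_j, and each nonzero intersection contains an eigenvector, so S permutes
    the V_j. If S V_i = V_j, then N_i and S^-1 N_j S are nilpotent
    transformations of V_i with the same invariant subspaces, and two such
    transformations are similar: a cyclic summand of maximal length of the one,
    together with an invariant complement, also reduces the other, which acts on
    this summand as a nilpotent cyclic block of the same size. Hence S preserves
    every W_l. Conversely, an invariant subspace is the sum of its intersections
    with the W_l, which gives the inclusion from right to left. *)
Require Import Defs.
From mathcomp Require Import all_boot all_order all_algebra.
From mathcomp Require Import classical_sets reals complex.

Set Implicit Arguments.
Unset Strict Implicit.
Unset Printing Implicit Defensive.

Import GRing.Theory.
Local Open Scope ring_scope.

(** * Polynomials evaluated at a linear map, and kernels of coprime factors *)

Section PrimaryDecomposition.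
Variables (K : fieldType) (V : vectType K) (A : 'End(V)).
Implicit Types (M : {vspace V}) (p q : {poly K}).

Lemma invariantP M :
  reflect {in M, forall x, A x \in M} (A @: M <= M)%VS.
Proof.
apply: (iffP subvP) => [AM x Mx | AM _ /memv_imgP[x Mx ->]]; last exact: AM.
by apply: AM; apply: memv_img.
Qed.

Lemma lfun_powE k x : lfun_pow A k x = iter k A x.
Proof. by elim: k => [|k IHk] /=; rewrite (id_lfunE, comp_lfunE) ?IHk. Qed.

Lemma iter_invariant M k x : (A @: M <= M)%VS -> x \in M -> iter k A x \in M.
Proof. by move=> /invariantP AM Mx; elim: k => //= k; apply: AM. Qed.

(** Coefficients beyond the size are 0. A free upper bound makes polynomials of different sizes
    comparable term by term. *)
Lemma lfun_horner_wide n p : (size p <= n)%N ->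
  lfun_horner A p = \sum_(i < n) p`_i *: lfun_pow A i.
Proof.
move=> le_p_n; rewrite /lfun_horner (big_ord_widen n (fun i =>
  p`_i *: lfun_pow A i)) //.
rewrite big_mkcond; apply: eq_bigr => i _; case: ltnP => // le_p_i.
by rewrite nth_default // scale0r.
Qed.

Lemma lfun_hornerD p q :
  lfun_horner A (p + q) = lfun_horner A p + lfun_horner A q.
Proof.
pose n := maxn (size p) (size q).
rewrite (lfun_horner_wide (size_polyD p q)) (@lfun_horner_wide n p) ?leq_maxl
  //.
rewrite (@lfun_horner_wide n q) ?leq_maxr // -big_split.
by apply: eq_bigr => i _; rewrite coefD scalerDl.
Qed.

Lemma lfun_hornerZ c p : lfun_horner A (c *: p) = c *: lfun_horner A p.
Proof.
rewrite (lfun_horner_wide (size_scale_leq c p)) scaler_sumr.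
by apply: eq_bigr => i _; rewrite coefZ scalerA.
Qed.

Lemma lfun_horner1 : lfun_horner A 1 = \1%VF.
Proof. by rewrite /lfun_horner size_poly1 big_ord1 coef1 scale1r. Qed.

Lemma lfun_hornerMX p : lfun_horner A (p * 'X) = (A \o lfun_horner A p)%VF.
Proof.
have le_pX : (size (p * 'X)%R <= (size p).+1)%N.
  by rewrite (leq_trans (size_polyMleq _ _)) // size_polyX addn2.
rewrite (lfun_horner_wide le_pX) big_ord_recl coefMX scale0r add0r.
apply/lfunP => x; rewrite comp_lfunE !sum_lfunE linear_sum.
by apply: eq_bigr => i _; rewrite coefMX !scale_lfunE linearZ comp_lfunE.
Qed.

Lemma lfun_hornerM p q :
  lfun_horner A (p * q) = (lfun_horner A p \o lfun_horner A q)%VF.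
Proof.
elim/poly_ind: p => [|p c IHp].
  by rewrite mul0r {2}/lfun_horner /lfun_horner size_poly0 !big_ord0
    comp_lfun0l.
rewrite mulrDl mulrAC mul_polyC !lfun_hornerD lfun_hornerZ !lfun_hornerMX IHp.
rewrite -[c%:P]alg_polyC lfun_hornerZ lfun_horner1 comp_lfunDl comp_lfunA.
by rewrite -comp_lfunZl comp_lfun1l.
Qed.

Lemma lfun_hornerXsubC_exp c k :
  lfun_horner A (('X - c%:P) ^+ k) = lfun_pow (A - c *: \1%VF) k.
Proof.
elim: k => [|k IHk]; first by rewrite expr0 lfun_horner1.
rewrite exprS lfun_hornerM IHk; congr comp_lfun.
rewrite -[c%:P]alg_polyC -scaleNr lfun_hornerD lfun_hornerZ lfun_horner1.
by rewrite -['X]mul1r lfun_hornerMX lfun_horner1 comp_lfun1r scaleNr.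
Qed.

Lemma lfun_horner_invariant M p x :
  (A @: M <= M)%VS -> x \in M -> lfun_horner A p x \in M.
Proof.
move=> AM Mx; rewrite sum_lfunE memv_suml // => i _.
by rewrite scale_lfunE memvZ // lfun_powE iter_invariant.
Qed.

Lemma lker_lfun_horner_invariant p :
  (A @: lker (lfun_horner A p) <= lker (lfun_horner A p))%VS.
Proof.
apply/invariantP => x; rewrite !memv_ker -!comp_lfunE => /eqP px0.
have <-: lfun_horner A ('X * p) = (lfun_horner A p \o A)%VF.
  by rewrite mulrC lfun_hornerM -['X]mul1r lfun_hornerMX lfun_horner1
    comp_lfun1r.
by rewrite mulrC lfun_hornerMX comp_lfunE px0 linear0.
Qed.

Lemma lker_lfun_horner_dvd p q :
  p %| q -> (lker (lfun_horner A p) <= lker (lfun_horner A q))%VS.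
Proof.
case/dvdpP=> u ->; apply/subvP => x; rewrite !memv_ker lfun_hornerM comp_lfunE.
by move/eqP->; rewrite linear0.
Qed.

(** A Bézout relation [u * p + v * q = 1], evaluated at [A], writes x as u(A) p(A) x + v(A) q(A) x,
    which is 0 when both kernels contain x. *)
Lemma lker_lfun_horner_coprime p q : coprimep p q ->
  (lker (lfun_horner A p) :&: lker (lfun_horner A q) = 0)%VS.
Proof.
case/Bezout_eq1_coprimepP=> [[u v] /= uv1]; apply/eqP; rewrite -subv0.
apply/subvP=> x; rewrite memv_cap !memv_ker memv0 => /andP[/eqP px0 /eqP qx0].
rewrite -[x]id_lfunE -lfun_horner1 -uv1 lfun_hornerD !lfun_hornerM.
by rewrite add_lfunE !comp_lfunE px0 qx0 !linear0 addr0.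
Qed.

(** The Bézout relation splits x in [M] into two terms, both in [M] by invariance. The term
    containing q(A) is killed by p(A), because p(A) q(A) x = 0, and symmetrically for the other. *)
Lemma sub_lker_lfun_hornerM p q M : coprimep p q -> (A @: M <= M)%VS ->
  (M <= lker (lfun_horner A (p * q)))%VS ->
  (M <= M :&: lker (lfun_horner A p) + M :&: lker (lfun_horner A q))%VS.
Proof.
case/Bezout_eq1_coprimepP=> [[u v] /= uv1] AM /subvP pqM.
apply/subvP=> x Mx; have /eqP pqx0 : lfun_horner A (p * q) x == 0.
  by rewrite -memv_ker pqM.
rewrite -[x]id_lfunE -lfun_horner1 -uv1 addrC lfun_hornerD add_lfunE.
apply: memv_add; rewrite memv_cap lfun_horner_invariant // memv_ker -comp_lfunE.
  by rewrite -lfun_hornerM mulrCA lfun_hornerM comp_lfunE pqx0 linear0 eqxx.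
by rewrite -lfun_hornerM mulrCA [q * p]mulrC lfun_hornerM comp_lfunE pqx0
  linear0 eqxx.
Qed.

Section Factors.
Variables (I : finType) (P : I -> {poly K}).
Hypothesis coP : forall i j, i != j -> coprimep (P i) (P j).

Lemma coprimep_prod_factors (r : seq I) (Q : pred I) i :
  (forall j, j \in r -> Q j -> i != j) ->
    coprimep (P i) (\prod_(j <- r | Q j) P j).
Proof.
move=> r'i; rewrite big_seq_cond; elim/big_ind: _ => [|p q co_p co_q|j /andP[]].
- exact: coprimep1.
- by rewrite coprimepMr co_p.
by move=> rj Qj; rewrite coP ?r'i.
Qed.

(** The kernels with index other than [i] all lie in the kernel of the product of the other factors,
    which is coprime to [P i]. *)
Lemma directv_lker_factors : directv (\sum_i lker (lfun_horner A (P i))).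
Proof.
apply/directv_sumP => i _; apply/eqP; rewrite -subv0.
have co_i : coprimep (P i) (\prod_(j | j != i) P j).
  by apply: coprimep_prod_factors => j _; rewrite eq_sym.
rewrite -[X in (_ <= X)%VS](lker_lfun_horner_coprime co_i) capvS //.
apply/subv_sumP => j i'j; apply: lker_lfun_horner_dvd.
by rewrite (bigD1 j) //= dvdp_mulIl.
Qed.

Lemma invariant_sub_sum_lker_factors M :
  lfun_horner A (\prod_i P i) = 0 -> (A @: M <= M)%VS ->
  (M <= \sum_i (M :&: lker (lfun_horner A (P i))))%VS.
Proof.
move=> P0 AM; have: (M <= lker (lfun_horner A (\prod_i P i)))%VS.
  by rewrite P0; apply/subvP => x _; rewrite memv_ker zero_lfunE.
(* Factors are split off one at a time. [M] stays general because the induction hypothesis is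
   applied to the part of [M] killed by the remaining product. *)
move: {P0} M AM; elim: index_enum (index_enum_uniq I) => [_|i r IHr /=] M AM.
  by rewrite !big_nil lfun_horner1 => /subvP M1; apply/subvP => x /M1;
    rewrite memv_ker id_lfunE memv0.
case/andP: M AM => r'i Ur M AM;
  rewrite !big_cons => /sub_lker_lfun_hornerM-/(_ _ AM) sM.
apply: subv_trans (sM _) _.
  by apply: coprimep_prod_factors => j rj _; apply: contraNneq r'i => ->.
rewrite addvS //; set M' := (_ :&: lker _)%VS.
have AM' : (A @: M' <= M')%VS.
  rewrite subv_cap (subv_trans (limgS _ (capvSl _ _))) //.
  by rewrite (subv_trans (limgS _ (capvSr _ _))) // lker_lfun_horner_invariant.
apply: subv_trans (IHr Ur M' AM' (capvSr _ _)) _.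
elim/big_ind2: _ => [|M1 M2 M3 M4|j _]; [exact: subvv | exact: addvS |].
by rewrite capvS // capvSl.
Qed.

End Factors.
End PrimaryDecomposition.

(** * Nilpotent maps: cyclic summands and common invariant subspaces *)

Section Nilpotent.
Variables (K : fieldType) (V : vectType K).
Implicit Types (f g : 'End(V)) (U M C D : {vspace V}) (v w x : V).

Lemma iter_lfun0 f k : iter k f 0 = 0.
Proof. by elim: k => //= k ->; rewrite linear0. Qed.

Lemma iter_lfunP f k c x w :
  iter k f (c *: x + w) = c *: iter k f x + iter k f w.
Proof. by rewrite -!lfun_powE linearP. Qed.

Lemma iter_lfun_span_traject f k j w x :
  iter k f w = 0 -> x \in <<traject f w j>>%VS -> iter k f x = 0.
Proof.
move=> fkw0; rewrite -lfun_powE; suff /subvP sub_ker: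
    (<<traject f w j>> <= lker (lfun_pow f k))%VS.
  by move/sub_ker; rewrite memv_ker => /eqP.
apply/span_subvP => _ /trajectP[i _ ->]; rewrite memv_ker lfun_powE -iterD.
by rewrite addnC iterD fkw0 iter_lfun0.
Qed.

(** If v were in the span of f v, f^2 v, ..., then f^k, which kills f v and hence its whole orbit,
    would kill v. *)
Lemma free_traject f k v :
  iter k f v != 0 -> iter k.+1 f v = 0 -> free (traject f v k.+1).
Proof.
elim: k v => [|k IHk] v fkv fv0; first by rewrite /= seq1_free.
rewrite [traject _ _ _]/= -[_ :: traject _ _ _]/(traject f (f v) k.+1).
rewrite free_cons IHk -?iterSr // andbT.
by apply: contraNN fkv => /(iter_lfun_span_traject _) ->; rewrite // -iterSr.
Qed.

Lemma span_traject_invariant f k v : iter k f v = 0 ->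
  (f @: <<traject f v k>> <= <<traject f v k>>)%VS.
Proof.
move=> fkv0; rewrite limg_span;
  apply/span_subvP => _ /mapP[_ /trajectP[i lt_ik ->] ->].
rewrite -iterS; have [lt_i1k|] := ltnP i.+1 k.
  by rewrite memv_span //; apply/trajectP; exists i.+1.
by move=> le_ki; rewrite (_ : i.+1 = k) ?fkv0 ?mem0v //; apply/eqP;
  rewrite eqn_leq lt_ik.
Qed.

Lemma span_traject_sub f k v M :
  (f @: M <= M)%VS -> v \in M -> (<<traject f v k>> <= M)%VS.
Proof.
move=> fM Mv; apply/span_subvP => _ /trajectP[i _ ->].
exact: iter_invariant.
Qed.

(** Take a functional [phi] with value 1 at f^k v, the last nonzero vector of the chain. The
    complement consists of the x in [U] with phi(f^i x) = 0 for all i; applying f only shifts i, so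
    it is invariant. *)
Lemma cyclic_complement f U k v : (f @: U <= U)%VS -> v \in U ->
    {in U, forall x, iter k.+1 f x = 0} -> iter k f v != 0 ->
  exists D : {vspace V},
    [/\ (D <= U)%VS, (f @: D <= D)%VS, (<<traject f v k.+1>> :&: D = 0)%VS &
        (<<traject f v k.+1>> + D = U)%VS].
Proof.
move=> fU Uv fU0 fkv; set C := <<_>>%VS.
have [phi phi1] : exists phi : 'Hom(V, K^o), phi (iter k f v) = 1.
  have [phi] := linear_of_free [:: iter k f v] [:: 1 : K^o].
  by rewrite seq1_free => /(_ fkv erefl)[phi1]; exists (linfun phi);
    rewrite lfunE.
pose D := (U :&: \bigcap_(i < k.+1) lker (phi \o lfun_pow f i)%VF)%VS.
(* The intersection runs over i <= k only; for larger i the condition is automatic, since f^(k+1)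
   vanishes on [U]. *)
have memD x : reflect (x \in U /\ forall i, phi (iter i f x) = 0) (x \in D).
  apply: (iffP memv_capP) => -[Ux phix0]; split=> //; first move=> i.
    have [le_ki|lt_ik] := leqP k.+1 i.
      by rewrite -(subnK le_ki) iterD fU0 // iter_lfun0 linear0.
    move: phix0; rewrite memvE => /subv_bigcapP/(_ (Ordinal lt_ik) isT).
    by rewrite -memvE memv_ker comp_lfunE lfun_powE => /eqP.
  rewrite memvE; apply/subv_bigcapP => i _.
  by rewrite -memvE memv_ker comp_lfunE lfun_powE phix0.
have CU : (C <= U)%VS by apply: span_traject_sub.
have DU : (D <= U)%VS by apply: capvSl.
exists D; split=> //.
- apply/invariantP => x /memD[Ux phix0]; apply/memD; split.
    by move/invariantP: fU; apply.
  by move=> i; rewrite -iterSr.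
- apply/eqP; rewrite -subv0; apply/subvP => x; rewrite memv_cap memv0.
  case/andP=> Cx /memD[_ phix0]; move: Cx; rewrite /C.
  (* The trivial equation is generalized to f^j w = f^k v, so that the chain can be shortened from
     its front: the value of phi at f^j x is the coefficient of w in x, so this coefficient is 0 and
     x lies in the span of the chain of f w. *)
  have: iter k f v = iter k f v by [].
  move: {1 3}k {1 3}v => j w; elim: j w => [|j IHj] w fjw.
    rewrite /= span_seq1 => /vlineP[c xE]; have := phix0 0.
    rewrite xE /= linearZ /= -[w]/(iter 0 f w) fjw phi1 => /eqP.
    by rewrite [_ *: _]mulr1 => /eqP->; rewrite scale0r.
  rewrite [traject _ _ _]/= -[_ :: traject _ _ _]/(traject f (f w) j.+1).
  rewrite span_cons => /memv_addP[_ /vlineP[c ->] [y Cy xE]].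
  suff c0 : c = 0 by apply: (IHj (f w));
    rewrite -?iterSr // xE c0 scale0r add0r.
  have := phix0 j.+1; rewrite xE iter_lfunP fjw linearP /= phi1 -iterS.
  rewrite (iter_lfun_span_traject _ Cy) ?linear0 ?addr0.
    by rewrite [_ *: _]mulr1.
  by rewrite -iterSr [iter _ _ _]iterS fjw -iterS fU0.
apply/eqP; rewrite eqEsubv subv_add CU DU /=; apply/subvP => x Ux.
(* Starting from x, the values phi (f^i x) are cancelled for i = k, ..., 0 by
   subtracting multiples of f^(k - i) v, which leaves the values for larger i
   untouched. *)
have: forall i, (k < i)%N -> phi (iter i f x) = 0.
  by move=> i le_ki; rewrite -(subnK le_ki) iterD fU0 // iter_lfun0 linear0.
move: (leqnn k.+1); move: {1 3}k.+1 => j;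
  elim: j x Ux => [|j IHj] x Ux le_jk phix0.
  by rewrite -[x]add0r memv_add ?mem0v //; apply/memD; split=> // i;
    apply: phix0.
pose w := (phi (iter j f x) : K) *: iter (k - j) f v.
have Cw : w \in C.
  by rewrite /w memvZ // memv_span //; apply/trajectP; exists (k - j)%N;
    rewrite // ltnS leq_subr.
rewrite -(subrK w x) memvD //; last by rewrite -[w]addr0 memv_add ?mem0v.
apply: IHj; first by rewrite memvB // (subvP CU).
  exact: ltnW.
move=> i; rewrite /w addrC -scaleNr iter_lfunP linearP /= -iterD.
rewrite leq_eqVlt => /predU1P[<-|lt_ji].
  by rewrite subnKC // phi1 [_ *: _]mulr1 addNr.
rewrite (phix0 i) //; have -> : (i + (k - j) = (i - j).-1 + k.+1)%N.
  by rewrite addnBA // addnS -addSn prednK ?subn_gt0 // addnBAC // ltnW.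
by rewrite iterD fU0 // iter_lfun0 linear0 scaler0 addr0.
Qed.

Lemma daddv_pi_eq0 U W x : (U :&: W = 0)%VS -> x \in W -> daddv_pi U W x = 0.
Proof.
move=> UW0 Wx; have WU0 : (W :&: U = 0)%VS by rewrite capvC.
have := daddv_pi_add UW0 (subvP (addvSr U W) _ Wx).
rewrite (daddv_pi_id WU0 Wx) => /eqP.
by rewrite -subr_eq0 addrK => /eqP.
Qed.

Lemma iter_lfun_nilp f k v : v != 0 -> iter k f v = 0 ->
  exists2 m, iter m f v != 0 & iter m.+1 f v = 0.
Proof.
move=> nz_v; elim: k => [v0|k IHk fkv]; first by move: nz_v;
  rewrite (v0 : v = 0) eqxx.
by have [/IHk//|nz] := eqVneq (iter k f v) 0; exists k.
Qed.

Lemma nilpotent_index f U k : U != 0%VS -> {in U, forall x, iter k f x = 0} ->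
  exists m, {in U, forall x, iter m.+1 f x = 0} /\
            exists2 v, v \in U & iter m f v != 0.
Proof.
move=> nzU; elim: k => [U0|k IHk fU0].
  by case/negP: nzU; rewrite -subv0; apply/subvP=> x /U0 /= ->; rewrite mem0v.
have [/subvP ker_k|] := boolP (U <= lker (lfun_pow f k))%VS.
  by apply: IHk => x /ker_k; rewrite memv_ker lfun_powE => /eqP.
case/subvPn=> v Uv; rewrite memv_ker lfun_powE => fkv.
by exists k; split=> //; exists v.
Qed.

(** Induction on the dimension of [U]: the similarity is glued from f^i v -> g^i v on a longest
    cyclic summand and the map that induction gives on its complement. *)
Lemma nilpotent_eq_invariant_similar f g U kf kg :
    (f @: U <= U)%VS -> (g @: U <= U)%VS ->
    {in U, forall x, iter kf f x = 0} -> {in U, forall x, iter kg g x = 0} ->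
    (forall M, (M <= U)%VS -> (f @: M <= M)%VS = (g @: M <= M)%VS) ->
  exists S : 'End(V), (S @: U = U)%VS /\ {in U, forall x, S (f x) = g (S x)}.
Proof.
have [n] := ubnP (\dim U); elim: n U kf => // n IHn U kf; rewrite ltnS => le_Un.
move=> fU gU fU0 gU0 fg.
have [->|nzU] := eqVneq U 0%VS.
  exists \1%VF; split; first exact: lim1g.
  by move=> x; rewrite memv0 => /eqP->; rewrite !linear0.
have [k [{}fU0 [v Uv fkv]]] := nilpotent_index nzU fU0.
have nz_v : v != 0 by apply: contraNneq fkv => ->; rewrite iter_lfun0.
have [m gmv gm1v] := iter_lfun_nilp nz_v (gU0 v Uv).
have fk1v := fU0 v Uv.
have [D [DU fD CD0 CDU]] := cyclic_complement fU Uv fU0 fkv.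
set C := <<_>>%VS in CD0 CDU.
have Cv : v \in C by rewrite memv_span //= mem_head.
(* [C] is the smallest f-invariant subspace containing v, hence also the smallest g-invariant
   one. *)
have eqC : (C = <<traject g v m.+1>>)%VS.
  apply/eqP; rewrite eqEsubv !span_traject_sub //.
  - by rewrite fg ?span_traject_sub // span_traject_invariant.
  - by rewrite memv_span //= mem_head.
  by rewrite -fg ?span_traject_invariant // -CDU addvSl.
have free_f := free_traject fkv fk1v; have free_g := free_traject gmv gm1v.
(* Both chains are bases of [C], so their lengths agree. *)
have eq_mk : m = k.
  move: free_g free_f; rewrite /free -eqC => /eqP-> /eqP.
  by rewrite !size_traject => -[].
have gD : (g @: D <= D)%VS by rewrite -fg.
have ltD : (\dim D < n)%N.
  rewrite (leq_trans _ le_Un) // -CDU dimv_disjoint_sum // -[X in (X <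
    _)%N]add0n.
  by rewrite ltn_add2r (eqnP free_f) size_traject.
have [|||SD [SDD SDfg]] := IHn D k.+1 ltD fD gD.
- by move=> x /(subvP DU)/fU0.
- by move=> x /(subvP DU)/gU0.
- by move=> M MD; rewrite fg // (subv_trans MD).
have [phi phiE] := linear_of_free (traject f v k.+1) (traject g v k.+1).
have {phiE}: [seq phi x | x <- traject f v k.+1] = traject g v k.+1.
  by apply: phiE; rewrite ?size_traject.
pose SC : 'End(V) := linfun phi.
rewrite -(eq_map (lfunE phi)) -/SC => SCE.
have SCi i : (i <= k)%N -> SC (iter i f v) = iter i g v.
  move=> le_ik; have := congr1 (fun s => nth 0 s i) SCE.
  rewrite (nth_map 0) ?size_traject // (set_nth_default v) ?size_traject //.
  by rewrite [RHS](set_nth_default v) ?size_traject // !nth_traject.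
have SCC : (SC @: C = C)%VS by rewrite limg_span SCE -eq_mk -eqC.
have SCfg : {in C, (SC \o f)%VF =1 (g \o SC)%VF}.
  apply/eqlfun_inP/span_subvP => _ /trajectP[i le_ik ->]; apply/eqlfunP.
  (* At the end of the chain, i = k, both sides are 0 because the two chains have equal length. *)
  rewrite !comp_lfunE (SCi i) // -!iterS; move: le_ik; rewrite ltnS leq_eqVlt.
  by case/predU1P=> [->|/SCi//]; rewrite fk1v linear0 -eq_mk gm1v.
pose S := ((SC \o daddv_pi C D) + (SD \o daddv_pi D C))%VF.
have SC_S : {in C, S =1 SC}.
  move=> x Cx; rewrite /S add_lfunE !comp_lfunE daddv_pi_id // daddv_pi_eq0 //.
    by rewrite linear0 addr0.
  by rewrite capvC.
have SD_S : {in D, S =1 SD}.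
  move=> x Cx; rewrite /S add_lfunE !comp_lfunE daddv_pi_eq0 // daddv_pi_id.
  - by rewrite linear0 add0r.
  - by rewrite capvC.
  by [].
exists S; split.
  by rewrite -CDU limgD (eq_in_limg SC_S) (eq_in_limg SD_S) SCC SDD.
move=> x; rewrite -CDU => /memv_addP[c Cc [d Dd ->]]; rewrite !linearD /=.
rewrite (SC_S c) // (SD_S d) // SC_S ?SD_S.
- by rewrite SDfg //; congr (_ + _); have := SCfg c Cc; rewrite !comp_lfunE.
- by move/invariantP: fD; apply.
by move/invariantP: (span_traject_invariant fk1v); apply.
Qed.

End Nilpotent.

(** * Restriction to invariant subspaces, and inverses in [Col] *)

Section Restriction.
Variables (K : fieldType) (V : vectType K).
Implicit Types (A S : 'End(V)) (U M : {vspace V}).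

Definition incl U : 'Hom(subvs_of U, V) := linfun (@vsval K V U).

Lemma inclE U u : incl U u = vsval u. Proof. exact: lfunE. Qed.

Lemma limg_incl U : limg (incl U) = U.
Proof.
apply/vspaceP => x; apply/memv_imgP/idP => [[u _ ->]|Ux].
  by rewrite inclE subvsP.
by exists (vsproj U x); rewrite ?memvf // inclE vsprojK.
Qed.

Lemma incl_preimK U M : (M <= U)%VS -> (incl U @: (incl U @^-1: M))%VS = M.
Proof. by move=> MU; rewrite lpreimK // limg_incl. Qed.

Lemma lker_incl U : lker (incl U) == 0%VS.
Proof. by apply/lker0P => u v; rewrite !inclE => /subvs_inj. Qed.

Lemma restrE U A u : A (vsval u) \in U -> vsval (restr U A u) = A (vsval u).
Proof. by move=> UAu; rewrite !comp_lfunE !lfunE /= vsprojK. Qed.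

Lemma eq_in_restr U A A' : {in U, A =1 A'} -> restr U A = restr U A'.
Proof. by move=> eqA; apply/lfunP => u;
  rewrite !comp_lfunE !lfunE /= eqA ?subvsP. Qed.

Lemma incl_limg_restr U A (M : {vspace subvs_of U}) :
  (A @: U <= U)%VS -> (incl U @: (restr U A @: M) = A @: (incl U @: M))%VS.
Proof.
move/invariantP=> AU; rewrite -!limg_comp; apply: eq_in_limg => u _.
by rewrite [LHS]comp_lfunE [RHS]comp_lfunE !inclE restrE // AU ?subvsP.
Qed.

Lemma Lat_restr U A (M : {vspace subvs_of U}) :
  (A @: U <= U)%VS -> Lat (restr U A) M <-> Lat A (incl U @: M)%VS.
Proof.
by move=> AU; rewrite /Lat /mkset -incl_limg_restr // limg_ker0 ?lker_incl.
Qed.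

Lemma bijective_lker0 A : bijective A <-> lker A == 0%VS.
Proof.
split=> [/bij_inj/lker0P // | kA].
by exists (A^-1)%VF; [apply: lker0_lfunK | apply: lker0_lfunVK].
Qed.

Lemma limg_invK S M : lker S == 0%VS -> (S^-1 @: (S @: M) = M)%VS.
Proof. by move=> kS; rewrite -limg_comp lker0_compVf // lim1g. Qed.

Lemma limg_invVK S M : lker S == 0%VS -> (S @: (S^-1 @: M) = M)%VS.
Proof. by move=> kS; rewrite -limg_comp lker0_compfV // lim1g. Qed.

Lemma bijective_inv S : bijective S -> bijective (S^-1)%VF.
Proof.
move/bijective_lker0=> kS; exists S; [exact: lker0_lfunVK | exact: lker0_lfunK].
Qed.

Lemma Col_inv A S : Col A S -> Col A (S^-1)%VF.
Proof.
case=> bijS latS; split=> [|M]; first exact: bijective_inv.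
by rewrite (latS (S^-1 @: M)%VS) limg_invVK //; apply/bijective_lker0.
Qed.

Lemma lfun_similar_restr A U U' (c c' : K) S :
    (A @: U <= U)%VS -> (A @: U' <= U')%VS ->
    (S @: U = U')%VS -> (U :&: lker S = 0)%VS ->
    {in U, forall x, S (A x - c *: x) = A (S x) - c' *: S x} ->
  lfun_similar (restr U A - c *: \1%VF) (restr U' A - c' *: \1%VF).
Proof.
move=> AU AU' SU kerS SA.
pose T : 'Hom(subvs_of U, subvs_of U') :=
  (linfun (@vsproj K V U') \o S \o incl U)%VF.
have TE u : vsval (T u) = S (vsval u).
  by rewrite !comp_lfunE inclE lfunE /= vsprojK // -SU memv_img ?subvsP.
have kT : lker T == 0%VS.
  rewrite -subv0; apply/subvP => u; rewrite memv_ker memv0 => /eqP Tu0.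
  have: vsval u \in (U :&: lker S)%VS.
    by rewrite memv_cap subvsP memv_ker -TE Tu0 linear0 eqxx.
  by rewrite kerS memv0 => /eqP u0; apply/eqP/subvs_inj; rewrite u0 linear0.
(* [T] joins two different spaces, so its right inverse is obtained from surjectivity, that is from
   [S @: U = U']. *)
have TVK : cancel (T^-1)%VF T.
  move=> y; apply: limg_lfunVK; have := subvsP y; rewrite -{2}SU.
  case/memv_imgP=> x Ux yE; apply/memv_imgP; exists (vsproj U x);
    rewrite ?memvf //.
  by apply: subvs_inj; rewrite TE vsprojK.
exists T; split; first by exists (T^-1)%VF; [exact: lker0_lfunK |].
apply/lfunP => y; rewrite [RHS]comp_lfunE [RHS]comp_lfunE -{1}[y]TVK.
set x := (T^-1)%VF y.
have restrE' W (u : subvs_of W) a : (A @: W <= W)%VS ->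
    vsval ((restr W A - a *: \1%VF) u) = A (vsval u) - a *: vsval u.
  move=> /invariantP AW; rewrite add_lfunE opp_lfunE scale_lfunE id_lfunE.
  by rewrite linearB linearZ /= restrE // AW ?subvsP.
by apply: subvs_inj; rewrite TE !restrE' // TE SA // subvsP.
Qed.

End Restriction.

Lemma lfun_similar_refl (K : fieldType) (V : vectType K) (N : 'End(V)) :
  lfun_similar N N.
Proof.
have k1 : lker (\1%VF : 'End(V)) == 0%VS.
  by apply/lker0P => x y; rewrite !id_lfunE.
exists \1%VF; split; first exact/bijective_lker0.
apply/lfunP => x; rewrite !comp_lfunE id_lfunE.
by rewrite -[in LHS](lker0_lfunVK k1 x) id_lfunE.
Qed.

(** * Maps defined componentwise on a direct sum *)

Section DirectSum.
Variables (K : fieldType) (V : vectType K) (I : finType) (U : I -> {vspace V}).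

(** The components of x given by the projections, and the family that is x at [i] and 0 elsewhere,
    have the same sum; uniqueness of decompositions identifies them. *)
Lemma sumv_pi_direct (P : pred I) i j x : directv (\sum_(i | P i) U i) ->
  P i -> P j -> x \in U i ->
    sumv_pi (\sum_(i | P i) U i)%VS j x = if j == i then x else 0.
Proof.
move=> /directv_sum_unique dU Pi Pj Ux.
pose us k := sumv_pi (\sum_(i | P i) U i)%VS k x;
  pose vs k := if k == i then x else 0.
have Uus k : P k -> us k \in U k by move=> _; apply: memv_sum_pi.
have Uvs k : P k -> vs k \in U k.
  by rewrite /vs; case: eqP => [->|]; rewrite ?mem0v.
have us_sum : \sum_(k | P k) us k = x.
  by apply: sumv_pi_sum; apply: (subvP (sumv_sup i Pi (subvv _))).
have := dU us vs Uus Uvs; rewrite us_sum.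
rewrite (bigD1 i) //= big1 => [|k /andP[_ /negPf i'k]]; last by rewrite /vs i'k.
by rewrite /vs eqxx addr0 eqxx => /esym/forall_inP/(_ j Pj)/eqP.
Qed.

Lemma dsumE (P : pred I) (T : forall i, 'End(subvs_of (U i))) i x :
    directv (\sum_(i | P i) U i) -> P i -> x \in U i ->
  dsum P T x = vsval (T i (vsproj (U i) x)).
Proof.
move=> dU Pi Ux; rewrite /dsum sum_lfunE [LHS](bigD1 i) //= [X in _ + X]big1
  => [|j /andP[Pj i'j]].
  by rewrite addr0 !comp_lfunE (sumv_pi_direct dU Pi Pi Ux) eqxx !lfunE.
by rewrite !comp_lfunE (sumv_pi_direct dU Pi Pj Ux) (negPf i'j) !linear0.
Qed.

Lemma eq_lfun_sum (P : pred I) (aT : vectType K) (f g : 'Hom(V, aT)) :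
  (\sum_(i | P i) U i = fullv)%VS -> (forall i, P i -> {in U i, f =1 g}) ->
    f = g.
Proof.
move=> sumU fg; apply/lfunP => x; have: x \in fullv by rewrite memvf.
rewrite -sumU => /memv_sumP[us Uus ->]; rewrite !linear_sum.
by apply: eq_bigr => i Pi; apply: (fg i Pi _ (Uus i Pi)).
Qed.

End DirectSum.

(** * Grouping the summands of a decomposition into blocks *)

Section Coarsening.
Variables (K : fieldType) (V : vectType K) (A : 'End(V)) (I J : finType).
Variables (U : I -> {vspace V}) (blk : I -> J) (block : J -> pred I).
Hypothesis blockE : forall l i, block l i = (blk i == l).
Hypothesis dU : directv (\sum_i U i).
Hypothesis AU : forall i, (A @: U i <= U i)%VS.
Hypothesis decA : forall M, (A @: M <= M)%VS -> (M <= \sum_i (M :&: U i))%VS.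

(* Abstracting W keeps the expression analysis behind directv from looking
   inside the blocks. *)
Variable W : J -> {vspace V}.
Hypothesis WE : forall l, W l = (\sum_(i | block l i) U i)%VS.

Lemma sum_blocks (F : I -> {vspace V}) :
  (\sum_i F i = \sum_l \sum_(i | block l i) F i)%VS.
Proof.
rewrite (partition_big blk xpredT) //=; apply: eq_bigr => l _.
by apply: eq_bigl => i; rewrite blockE.
Qed.

Lemma directv_block l : directv (\sum_(i | block l i) U i).
Proof.
apply/directv_sumP => i bi; apply/eqP; rewrite -subv0.
rewrite -[X in (_ <= X)%VS](directv_sumP dU i isT) capvS //.
by apply/subv_sumP => j /andP[_ i'j]; apply: (sumv_sup j).
Qed.

(** Dimension count: the blocks span the same sum as the [U i], and each [W l] has dimension at most
    the sum over its own components. *)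
Lemma directv_blocks : directv (\sum_l W l).
Proof.
rewrite directvEgeq /= (eq_bigr _ (fun l _ =>
  WE l)) -sum_blocks (directvP dU) /=.
rewrite (partition_big blk xpredT) //=; apply: leq_sum => l _.
rewrite WE (leq_trans (dimv_leq_sum _ _ _)) //; apply/eq_leq/eq_bigl => i.
by rewrite blockE.
Qed.

Lemma sum_blocks_full : (\sum_l W l = fullv)%VS.
Proof.
apply/eqP; rewrite (eq_bigr _ (fun l _ => WE l)) -sum_blocks eqEsubv subvf /=.
apply: subv_trans (decA (subvf _)) _; apply/subv_sumP => i _.
by rewrite (sumv_sup i) // capvSr.
Qed.

Lemma block_invariant l : (A @: W l <= W l)%VS.
Proof.
by rewrite WE limg_sum; apply/subv_sumP => i bi; apply: (sumv_sup i bi (AU i)).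
Qed.

Lemma block_decomposition M :
  (A @: M <= M)%VS -> (M = \sum_l (M :&: W l))%VS.
Proof.
move=> AM; apply/eqP; rewrite eqEsubv; apply/andP; split; last first.
  by apply/subv_sumP => l _; apply: capvSl.
apply: subv_trans (decA AM) _; rewrite sum_blocks; apply/subv_sumP => l _.
rewrite (sumv_sup l) //; apply/subv_sumP => i bi.
by rewrite capvS // WE (sumv_sup i).
Qed.

(** Identifies the operator [B l] of the theorem with the restriction of [A] to the block, so that
    [A] alone has to be studied. *)
Lemma dsum_restr_block l :
  restr (W l) (dsum (block l) (fun i => restr (U i) A)) = restr (W l) A.
Proof.
apply: eq_in_restr => x; rewrite WE => /memv_sumP[us Uus ->];
  rewrite !linear_sum.
apply: eq_bigr => i bi; have Uui := Uus i bi.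
rewrite /= (dsumE _ (directv_block l) bi Uui) restrE vsprojK //.
by move/invariantP: (AU i); apply.
Qed.

(** An invariant [M] is the sum of its parts in the [W l], and on [W l] the direct sum acts as
    [T l]; each part can thus be treated inside its block. *)
Lemma dsum_Lat (T : forall l, 'End(subvs_of (W l))) M :
    (forall l N, Lat (restr (W l) A) N -> Lat (restr (W l) A) (T l @: N)%VS) ->
  Lat A M -> Lat A (dsum xpredT T @: M)%VS.
Proof.
move=> latT AM; rewrite /Lat /mkset (block_decomposition AM) !limg_sum.
apply/subv_sumP => l _; rewrite (sumv_sup l) //; set M' := (M :&: _)%VS.
have AM' : (A @: M' <= M')%VS.
  by apply: subv_trans (limg_cap _ _ _) _; rewrite capvS // block_invariant.
have M'W : (M' <= W l)%VS by apply: capvSr.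
have -> : (dsum xpredT T @: M' = incl (W l) @: (T l @: (incl (W l) @^-1:
  M')))%VS.
  rewrite -{1}(incl_preimK M'W) -!limg_comp; apply: eq_in_limg => u _.
  by rewrite !comp_lfunE !inclE (@dsumE _ _ _ W xpredT T l) ?vsvalK ?subvsP
    // directv_blocks.
apply/(Lat_restr _ (block_invariant l))/latT/(Lat_restr _ (block_invariant l)).
by rewrite incl_preimK.
Qed.

Lemma dsum_comp (T T' : forall l, 'End(subvs_of (W l))) :
  (forall l, T l \o T' l = \1)%VF -> (dsum xpredT T \o dsum xpredT T' = \1)%VF.
Proof.
move=> TT'; apply: (eq_lfun_sum sum_blocks_full) => l _ x Wx.
rewrite comp_lfunE (@dsumE _ _ _ W xpredT T' l _ directv_blocks) //.
rewrite (@dsumE _ _ _ W xpredT T l _ directv_blocks) ?subvsP //.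
by rewrite vsvalK -comp_lfunE TT' !id_lfunE vsprojK.
Qed.

Lemma dsum_Col (T : forall l, 'End(subvs_of (W l))) :
  (forall l, Col (restr (W l) A) (T l)) -> Col A (dsum xpredT T).
Proof.
move=> colT; pose T' l := (T l)^-1%VF.
have kT l : lker (T l) == 0%VS by have [/bijective_lker0] := colT l.
have TT' : (dsum xpredT T \o dsum xpredT T' = \1)%VF.
  by apply: dsum_comp => l; rewrite lker0_compfV.
have T'T : (dsum xpredT T' \o dsum xpredT T = \1)%VF.
  by apply: dsum_comp => l; rewrite lker0_compVf.
split=> [|M].
  exists (dsum xpredT T') => x; rewrite -comp_lfunE ?TT' ?T'T id_lfunE //.
split; first by apply: dsum_Lat => l N /(colT l).2.
(* For the converse, [M] is recovered from its image by the direct sum of the inverses, which also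
   preserve the lattices. *)
rewrite -{2}[M]lim1g -T'T limg_comp; apply: dsum_Lat => l N.
by move/((Col_inv (colT l)).2 N).
Qed.

Lemma Col_dsum S : Col A S -> (forall l, (S @: W l <= W l)%VS) ->
  (forall l, Col (restr (W l) A) (restr (W l) S)) /\
  dsum xpredT (fun l => restr (W l) S) = S.
Proof.
move=> [/bijective_lker0/lker0P injS latS] SW; split=> [l|].
  split=> [|M]; last first.
    rewrite !Lat_restr ?block_invariant // incl_limg_restr //; exact: latS.
  apply/bijective_lker0/lker0P => u v /(congr1 vsval).
  by rewrite !restrE ?(invariantP _ _ (SW l)) ?subvsP // => /injS/subvs_inj.
apply: (eq_lfun_sum sum_blocks_full) => l _ x Wx.
rewrite (@dsumE _ _ _ W xpredT _ l _ directv_blocks) // restrE vsprojK //.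
exact: (invariantP _ _ (SW l)).
Qed.

End Coarsening.

(** * Action of [Col A] on the primary components *)

Section PrimaryComponents.
Variables (K : fieldType) (V : vectType K) (A : 'End(V)) (I : finType).
Variables (lambda : I -> K) (n : I -> nat).
Hypothesis lambda_inj : injective lambda.
Hypothesis A_ann : lfun_horner A (\prod_i ('X - (lambda i)%:P) ^+ n i) = 0.

Local Notation N i := (A - lambda i *: \1%VF).
Local Notation U i := (lker (lfun_pow (N i) (n i))).

Lemma Col_neq0 S x : Col A S -> x != 0 -> S x != 0.
Proof.
case=> /bij_inj injS _; apply: contraNneq => Sx0.
by apply/eqP/injS; rewrite Sx0 linear0.
Qed.

Lemma coprimep_primary_factors i j : i != j ->
  coprimep (('X - (lambda i)%:P) ^+ n i) (('X - (lambda j)%:P) ^+ n j).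
Proof.
move=> i'j; rewrite coprimep_expl // coprimep_expr // coprimep_XsubC2 //.
by rewrite subr_eq0 (inj_eq lambda_inj) eq_sym.
Qed.

Lemma directv_primary : directv (\sum_i U i).
Proof.
apply/directv_sumP => i _; rewrite -lfun_hornerXsubC_exp.
under eq_bigr do rewrite -lfun_hornerXsubC_exp.
exact: (directv_sumP (directv_lker_factors A coprimep_primary_factors) i isT).
Qed.

Lemma primary_decomposition M :
  (A @: M <= M)%VS -> (M <= \sum_i (M :&: U i))%VS.
Proof.
move/(invariant_sub_sum_lker_factors coprimep_primary_factors A_ann).
by under eq_bigr do rewrite lfun_hornerXsubC_exp.
Qed.

Lemma primary_invariant i : (A @: U i <= U i)%VS.
Proof. by rewrite -lfun_hornerXsubC_exp lker_lfun_horner_invariant. Qed.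

Lemma shift_invariant c M :
  ((A - c *: \1%VF) @: M <= M)%VS = (A @: M <= M)%VS.
Proof.
have shE x : (A - c *: \1%VF) x = A x - c *: x.
  by rewrite add_lfunE opp_lfunE scale_lfunE id_lfunE.
apply/invariantP/invariantP => AM x Mx; last by rewrite shE memvB ?AM ?memvZ.
by rewrite -(subrK (c *: x) (A x)) -shE memvD ?AM ?memvZ.
Qed.

(** Apply [N i] repeatedly to a nonzero vector of [M]: the last nonzero iterate is the
    eigenvector. *)
Lemma primary_eigenvector i M : (A @: M <= M)%VS -> (M <= U i)%VS ->
  M != 0%VS ->
  exists x, [/\ x \in M, x != 0 & A x = lambda i *: x].
Proof.
move=> AM /subvP MU nzM; have Mv := memv_pick M; set v := vpick M in Mv.
have [||m nz_x Nx0] := @iter_lfun_nilp _ _ (N i) (n i) v;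
  first by rewrite vpick0.
  by apply/eqP; rewrite -lfun_powE -memv_ker MU.
exists (iter m (N i) v); split=> //.
  by apply: iter_invariant; rewrite ?shift_invariant.
move: Nx0; rewrite iterS add_lfunE opp_lfunE scale_lfunE id_lfunE.
by move/eqP; rewrite subr_eq0 => /eqP.
Qed.

Lemma primary_eigenvalue i x a :
  x \in U i -> x != 0 -> A x = a *: x -> a = lambda i.
Proof.
rewrite memv_ker lfun_powE => Ux nzx Ax.
have NE k : iter k (N i) x = (a - lambda i) ^+ k *: x.
  elim: k => [|k IHk]; first by rewrite scale1r.
  rewrite iterS IHk linearZ /= add_lfunE opp_lfunE scale_lfunE id_lfunE Ax.
  by rewrite -scalerBl scalerA -exprSr.
move: Ux; rewrite NE scaler_eq0 (negPf nzx) orbF expf_eq0 subr_eq0.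
by case/andP=> _ /eqP.
Qed.

Lemma primary_meet_invariant i M : (A @: M <= M)%VS ->
  (A @: (M :&: U i) <= M :&: U i)%VS.
Proof.
by move=> AM; apply: subv_trans (limg_cap _ _ _) _;
  rewrite capvS ?primary_invariant.
Qed.

Section Collineation.
Variable S : 'End(V).
Hypothesis colS : Col A S.

Lemma Col_eigenvector x a : A x = a *: x -> exists b, A (S x) = b *: S x.
Proof.
move=> Ax; have : Lat A <[x]>%VS.
  by rewrite /Lat /mkset limg_line Ax -memvE memvZ ?memv_line.
move/(colS.2 _); rewrite /Lat /mkset !limg_line -memvE.
by move/vlineP.
Qed.

(* S (x + y) is again an eigenvector, which forces the eigenvalues of S x and
   S y to agree. *)
Lemma Col_eigenvalue x y a b c : x != 0 -> y != 0 ->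
  A x = a *: x -> A y = a *: y -> A (S x) = b *: S x -> A (S y) = c *: S y ->
  b = c.
Proof.
move=> nzx nzy Ax Ay ASx ASy.
have nzS z : z != 0 -> S z != 0 by apply: Col_neq0.
have [|d] := @Col_eigenvector (x + y) a;
  first by rewrite linearD /= Ax Ay scalerDr.
rewrite !linearD /= ASx ASy => /eqP.
rewrite -subr_eq0 opprD addrACA -!scalerBl addr_eq0 -scaleNr opprB => /eqP e.
(* Here (b - d) S x = (d - c) S y. If b = d, then c = d since S y is nonzero; otherwise S x is a
   multiple of S y and has its eigenvalue c. *)
have [bd|nbd] := eqVneq b d.
  move: e; rewrite bd subrr scale0r => /eqP; rewrite eq_sym scaler_eq0.
  by rewrite (negPf (nzS y nzy)) orbF subr_eq0 => /eqP.
have SxE : S x = ((b - d)^-1 * (d - c)) *: S y.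
  by rewrite -scalerA -e scalerA mulVf ?scale1r // subr_eq0.
have := ASx; rewrite {1}SxE linearZ /= ASy scalerA mulrC -scalerA -SxE.
by move/eqP; rewrite -subr_eq0 -scalerBl scaler_eq0 (negPf (nzS x nzx)) orbF
  subr_eq0 => /eqP.
Qed.

End Collineation.

Lemma Col_maps_primary_sub S i : Col A S -> U i != 0%VS ->
  exists j, (S @: U i <= U j)%VS.
Proof.
move=> colS nzUi; have /bijective_lker0 kS := colS.1.
have [x [Ux nzx Ax]] := primary_eigenvector (primary_invariant i) (subvv _)
  nzUi.
have [b ASx] := Col_eigenvector colS Ax.
have nzSx := Col_neq0 colS nzx.
have AL : (A @: <[S x]> <= <[S x]>)%VS by rewrite limg_line ASx -memvE memvZ
  ?memv_line.
(* The target index [j] is found from the invariant line spanned by S x, which must meet some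
   primary component. *)
have [j nzj] : exists j, (<[S x]> :&: U j != 0)%VS.
  apply/existsP; apply: contraNT nzSx => /existsPn L0; rewrite -memv0.
  have := subvP (primary_decomposition AL) _ (memv_line _).
  by rewrite big1 // => j _; apply/eqP; have := L0 j; rewrite negbK.
have [y [/memv_capP[/vlineP[c yE] Uy] nzy Ay]] :=
  primary_eigenvector (primary_meet_invariant j AL) (capvSr _ _) nzj.
have bj : b = lambda j.
  by apply: (primary_eigenvalue Uy nzy);
    rewrite yE linearZ /= ASx scalerA mulrC -scalerA.
exists j; have AM : (A @: (S @: U i) <= S @: U i)%VS by apply/(colS.2 (U i));
  apply: primary_invariant.
apply: subv_trans (primary_decomposition AM) _; apply/subv_sumP => k _.
have [->|nzk] := eqVneq (S @: U i :&: U k)%VS 0%VS; first exact: sub0v.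
(* A nonzero part of the image in [U k] contains an eigenvector z = S w. Then w is an eigenvector in
   [U i], with the same eigenvalue as x, so S w and S x share theirs and k = j. *)
have [z [/memv_capP[/memv_imgP[w Uw zE] Uz] nzz Az]] :=
  primary_eigenvector (primary_meet_invariant k AM) (capvSr _ _) nzk.
have nzw : w != 0 by apply: contraNneq nzz => w0; rewrite zE w0 linear0.
have [a Aw] := Col_eigenvector (Col_inv colS) Az.
rewrite zE lker0_lfunK // in Aw.
have aE := primary_eigenvalue Uw nzw Aw; rewrite aE in Aw.
have ASw : A (S w) = lambda k *: S w by rewrite -zE.
have := Col_eigenvalue colS nzx nzw Ax Aw ASx ASw.
by rewrite bj => /lambda_inj ->; apply: capvSr.
Qed.

(** S maps [U i] into some [U j], and the inverse of S maps [U j] into some [U k]. A nonzero [U i]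
    inside [U k] forces k = i by directness, so the first inclusion is an equality. *)
Lemma Col_permutes_primary S i : Col A S -> exists j, (S @: U i = U j)%VS.
Proof.
move=> colS; have [Ui0|nzUi] := eqVneq (U i) 0%VS.
  by exists i; rewrite Ui0 limg0.
have /bijective_lker0 kS := colS.1.
have [j sUij] := Col_maps_primary_sub colS nzUi; exists j.
have nzUj : U j != 0%VS.
  apply: contraNneq nzUi => Uj0; move: sUij.
  by rewrite Uj0 -[X in (_ <= X)%VS](limg0 S) limg_ker0 // subv0.
have [k sUjk] := Col_maps_primary_sub (Col_inv colS) nzUj.
have sUik : (U i <= U k)%VS.
  by rewrite -(limg_invK (U i) kS); apply: subv_trans (limgS _ sUij) sUjk.
have ki : k = i.
  apply/eqP; apply: contraNT nzUi => i'k; rewrite -subv0.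
  rewrite -[X in (_ <= X)%VS](directv_sumP directv_primary i isT).
  by rewrite subv_cap subvv (sumv_sup k).
apply/eqP; rewrite eqEsubv sUij -[X in (X <= _)%VS](limg_invVK _ kS).
by rewrite limgS // -ki.
Qed.

Lemma Col_primary_similar S i j : Col A S -> (S @: U i = U j)%VS ->
  lfun_similar (restr (U i) A - lambda i *: \1%VF) (restr (U j) A - lambda j
    *: \1%VF).
Proof.
move=> colS SU; have /bijective_lker0 kS := colS.1.
have SVU : (S^-1 @: U j = U i)%VS by rewrite -SU limg_invK.
(* [N j] pulled back along S has the same invariant subspaces as [A], because S preserves invariance
   in both directions. *)
pose g : 'End(V) := (S^-1 \o N j \o S)%VF.
have limg_g M : (g @: M = S^-1 @: (N j @: (S @: M)))%VS by rewrite !limg_comp.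
have gM M : (g @: M <= M)%VS = (A @: M <= M)%VS.
  rewrite limg_g -[X in (_ <= X)%VS](limg_invK _ kS) limg_ker0; last first.
    by have /bijective_lker0 := (Col_inv colS).1.
  by rewrite shift_invariant; apply/idP/idP => /(colS.2 M).
have iter_g k x : iter k g x = (S^-1)%VF (iter k (N j) (S x)).
  elim: k => [|k IHk]; first by rewrite /= lker0_lfunK.
  by rewrite !iterS IHk !comp_lfunE lker0_lfunVK.
have [|||x Ux|M _|Q [QU Qfg]] :=
    @nilpotent_eq_invariant_similar _ _ (N i) g (U i) (n i) (n j).
- by rewrite shift_invariant primary_invariant.
- by rewrite gM primary_invariant.
- by move=> x; rewrite memv_ker lfun_powE => /eqP.
- rewrite iter_g -lfun_powE; have: S x \in U j by rewrite -SU memv_img.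
  by rewrite memv_ker => /eqP->; rewrite linear0.
- by rewrite shift_invariant gM.
(* [Q] carries [N i] to [g] on [U i], and S carries [g] to [N j]. *)
apply: (@lfun_similar_restr _ _ _ _ _ _ _ (S \o Q)%VF);
  rewrite ?primary_invariant //.
- by rewrite limg_comp QU.
(* Rank-nullity on [U i]: its image under [S \o Q] is [S @: U i], of full dimension, so the kernel
   meets [U i] in 0. *)
- have := limg_ker_dim (S \o Q)%VF (U i); rewrite limg_comp QU limg_dim_eq.
    by move/eqP; rewrite -{2}[\dim (U i)]add0n eqn_add2r dimv_eq0 => /eqP.
  by move/eqP: kS => ->; rewrite capv0.
move=> x Ux; have := Qfg x Ux.
rewrite !add_lfunE !opp_lfunE !scale_lfunE !id_lfunE => QN.
by rewrite comp_lfunE QN !comp_lfunE lker0_lfunVK // add_lfunE opp_lfunE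
  scale_lfunE id_lfunE.
Qed.

Theorem Col_primary_blocks (J : finType) (blk : I -> J) (block : J -> pred I)
    (blockE : forall l i, block l i = (blk i == l))
    (blk_similar : forall i j,
       lfun_similar (restr (U i) A - lambda i *: \1%VF)
                    (restr (U j) A - lambda j *: \1%VF) -> blk i = blk j)
    (W := fun l => (\sum_(i | block l i) U i)%VS) :
  Col A = dsum_set (fun l => Col (restr (W l) (dsum (block l) (fun i =>
    restr (U i) A)))).
Proof.
have WE l : W l = (\sum_(i | block l i) U i)%VS by [].
have BE := dsum_restr_block directv_primary primary_invariant WE.
apply/seteqP; split=> [S colS | _ [T colT <-]]; last first.
  apply: (dsum_Col blockE directv_primary primary_invariant
    primary_decomposition WE).
  by move=> l; rewrite -BE; apply: colT.
(* S sends each component of the block onto a component with similar nilpotent part, which carries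
   the same label [blk]. *)
have SW l : (S @: W l <= W l)%VS.
  rewrite limg_sum; apply/subv_sumP => i bi.
  have [j SU] := Col_permutes_primary i colS; rewrite SU (sumv_sup j) //.
  by rewrite blockE -(blk_similar _ _ (Col_primary_similar colS SU)) -blockE.
have [colT <-] := Col_dsum blockE directv_primary primary_invariant
  primary_decomposition WE colS SW.
by exists (fun l => restr (W l) S) => // l; rewrite BE.
Qed.

End PrimaryComponents.

(** * The complex case, with blocks given by consecutive index ranges *)

Local Open Scope complex_scope.

Theorem proposition6 (R : realType) (V : vectType R[i]) (A : 'End(V))
    (s : nat) (lambda : 'I_s -> R[i]) (n : 'I_s -> nat)
    (lambda_inj : injective lambda)
    (lambda_eig : forall a : R[i],
       passmx.leigenvalue A a <-> exists j : 'I_s, lambda j = a)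
    (minA : is_minpoly A (\prod_(j < s) ('X - (lambda j)%:P) ^+ n j)) :
  let Vj (j : 'I_s) : {vspace V} :=
    lker (lfun_pow (A - lambda j *: \1%VF) (n j)) in
  let Aj (j : 'I_s) : 'End(subvs_of (Vj j)) := restr (Vj j) A in
  let N (j : 'I_s) : 'End(subvs_of (Vj j)) := Aj j - lambda j *: \1%VF in
  forall (t : nat) (b : nat -> nat)
    (b0 : b 0%N = 0%N) (bt : b t = s)
    (b_incr : forall l : nat, (l < t)%N -> (b l < b l.+1)%N),
  let block (l : 'I_t) : pred 'I_s := fun j => (b l <= j < b l.+1)%N in
  forall (block_similar : forall i j : 'I_s,
    (exists l : 'I_t, block l i /\ block l j) <-> lfun_similar (N i) (N j)),
  let W (l : 'I_t) : {vspace V} := (\sum_(j | block l j) Vj j)%VS in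
  let B (l : 'I_t) : 'End(subvs_of (W l)) :=
    restr (W l) (dsum (block l) Aj) in
  Col A = dsum_set (fun l : 'I_t => Col (B l)).
Proof.
move=> Vj Aj N t b b0 bt b_incr block block_similar W B.
have b_mono l m : (l <= m <= t)%N -> (b l <= b m)%N.
  elim: m => [|m IHm]; first by rewrite leqn0 => /andP[/eqP->].
  rewrite leq_eqVlt => /andP[/predU1P[-> //|]]; rewrite ltnS => le_lm lt_mt.
  by rewrite (leq_trans _ (ltnW (b_incr m lt_mt))) // IHm // le_lm ltnW.
(* Blocks are disjoint: for l < l', membership in both would give j < b(l + 1) <= b(l') <= j. *)
have block_inj l l' j : block l j -> block l' j -> l = l'.
  wlog lt_ll' : l l' / (l < l')%N => [wlog_lt bl bl'|].
    case: (ltngtP l l') => [lt_ll'|lt_l'l|/val_inj//].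
      exact: wlog_lt lt_ll' bl bl'.
    exact/esym/(wlog_lt _ _ lt_l'l bl' bl).
  case/andP=> _ lt_j /andP[le_j _].
  have := leq_trans lt_j (b_mono l.+1 l' _); rewrite lt_ll' ltnW // => /(_ isT).
  by rewrite ltnNge le_j.
(* That the blocks cover all indices follows from similarity of [N j] with itself. *)
have block_ex j : exists l, block l j.
  have [|l [] //] := (block_similar j j).2; last by exists l.
  exact: lfun_similar_refl.
pose blk j := xchoose (block_ex j).
have blockE l j : block l j = (blk j == l).
  apply/idP/eqP => [bl|<-]; last exact: (xchooseP (block_ex j)).
  exact: block_inj (xchooseP (block_ex j)) bl.
have [_ A_ann _] := minA.
apply: (Col_primary_blocks lambda_inj A_ann blockE) => i j /block_similar[l [bi bj]].
by move: bi bj; rewrite !blockE => /eqP-> /eqP->.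
Qed.
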